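(* Let $\mathfrak g=\mathfrak h\rtimes_D\mathbb R$ be a $2n$-dimensional almost abelian Lie algebra, with codimension-one abelian ideal $\mathfrak h$, equipped with an almost pseudo-Hermitian structure $(J,g)$ such that $\mathfrak h_0=\mathfrak h^\perp\oplus J\mathfrak h^\perp$ is isotropic. Let $\{e_1,\dots,e_{2n}\}$ be a basis of $\mathfrak g$ such that $\mathfrak h=\mathrm{Span}\{e_1,\dots,e_{2n-1}\}$, $\mathfrak h^\perp=\mathrm{Span}\{e_1\}$, $D=\mathrm{ad}(e_{2n})|_{\mathfrak h}$, $$Je_{2i-1}=e_{2i}\ (1\le i\le n),\qquad g=e^1\odot e^{2n}-e^2\odot e^{2n-1}+\sum_{i=3}^{2n-2}\varepsilon_i\,e^i\otimes e^i,\qquad \varepsilon_i\in\{-1,+1\},$$ and let $V=\mathrm{Span}\{e_3,\dots,e_{2n-2}\}$ with the restrictions $J_V,g_V$ of $J,g$. Then $(J,g)$ defines a pseudo-Kähler structure on $\mathfrak g$ if and only if, with respect to $\mathfrak h=\mathrm{Span}\{e_1\}\oplus\mathrm{Span}\{e_2\}\oplus V\oplus\mathrm{Span}\{e_{2n-1}\}$, $$D=\begin{pmatrix}-a&0&-(J_Vv)^{\flat_V}&c_1\\0&-a&v^{\flat_V}&c_2\\0&0&A&v\\0&0&0&a\end{pmatrix}$$ with $A\in\mathfrak u(V,J_V,g_V)$, $v\in V$ and $a,c_1,c_2\in\mathbb R$.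
   Context: Lie algebras are real. $\mathfrak g$ is almost abelian if it has a codimension-one abelian ideal $\mathfrak h$; then $\mathfrak g=\mathfrak h\rtimes_D\mathrm{Span}\{e_{2n}\}$ with $D=\mathrm{ad}(e_{2n})|_{\mathfrak h}\in\mathrm{End}(\mathfrak h)$ for a chosen $e_{2n}\notin\mathfrak h$. An almost pseudo-Hermitian structure is a pair $(J,g)$ with $J^2=-\mathrm{Id}$ and $g$ a nondegenerate symmetric bilinear form with $g(JX,JY)=g(X,Y)$. It is pseudo-Kähler if moreover $[X,Y]+J[JX,Y]+J[X,JY]-[JX,JY]=0$ for all $X,Y$ and $\omega=g(J\cdot,\cdot)$ is closed, i.e. $\omega([X,Y],Z)+\omega([Y,Z],X)+\omega([Z,X],Y)=0$. The space $\mathfrak h^\perp$ is one-dimensional; $\mathfrak h_0=\mathfrak h^\perp\oplus J\mathfrak h^\perp$ is called isotropic if $g|_{\mathfrak h_0}=0$ (otherwise $g|_{\mathfrak h_0}$ is definite). In the isotropic case a basis as in the claim always exists. Notation: $\{e^i\}$ is the dual basis, $e^i\odot e^j=e^i\otimes e^j+e^j\otimes e^i$, $v^{\flat_V}=g_V(v,\cdot)\in V^*$, and $\mathfrak u(V,J_V,g_V)$ is the Lie algebra of endomorphisms of $V$ that commute with $J_V$ and are skew-symmetric with respect to $g_V$. *)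

(* Defs.v *)
From HB Require Import structures.
From mathcomp Require Import all_boot all_order all_algebra.
From mathcomp Require Import reals.

Set Implicit Arguments.
Unset Strict Implicit.
Unset Printing Implicit Defensive.

Import Order.TTheory GRing.Theory Num.Theory.
Local Open Scope ring_scope.

Section LieAlgebras.
Variables (R : fieldType) (L : vectType R).
Implicit Types (br : {bilinear L -> L -> L}) (h : {vspace L}).

Definition is_lie_bracket br : Prop :=
  (forall x, br x x = 0) /\
  (forall x y z, br x (br y z) + br y (br z x) + br z (br x y) = 0).

Definition ad br (x : L) : 'End(L) := linfun (br x).

Definition codim1_abelian_ideal br h : Prop :=
  [/\ (\dim h).+1 = \dim {:L},
      forall x y, y \in h -> br x y \in h
    & {in h &, forall x y, br x y = 0}].

End LieAlgebras.

Section Restrictions.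
Variables (R : fieldType) (L : vectType R).

(* f|_U as an endomorphism of U.  [vsproj U] is a linear projection onto U, so
   this is the restriction of f only when f maps U into itself. *)
Definition restr_end (U : {vspace L}) (f : 'End(L)) : 'End(subvs_of U) :=
  (linfun (vsproj U) \o f \o linfun (@vsval _ _ U))%VF.

Definition restr_form (U : {vspace L}) (g : L -> L -> R) :
    subvs_of U -> subvs_of U -> R :=
  fun x y => g (vsval x) (vsval y).

Definition flat (g : L -> L -> R) (v : L) : L -> R := g v.

(* Membership in u(L, J, g). *)
Definition unitary_lie (J : 'End(L)) (g : L -> L -> R) (A : 'End(L)) : Prop :=
  (A \o J)%VF = (J \o A)%VF /\ (forall x y, g (A x) y = - g x (A y)).

End Restrictions.

Section PseudoKahler.
Variables (R : fieldType) (L : vectType R).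
Implicit Types (br : {bilinear L -> L -> L}) (J : 'End(L)) (g : {symmetric L}).

Definition almost_pseudo_hermitian J g : Prop :=
  [/\ forall x, J (J x) = - x,
      nondegenerate g
    & forall x y, g (J x) (J y) = g x y].

Definition integrable br J : Prop := forall x y,
  br x y + J (br (J x) y) + J (br x (J y)) - br (J x) (J y) = 0.

Definition fundamental_form J g : L -> L -> R := fun x y => g (J x) y.

Definition closed_form br (w : L -> L -> R) : Prop := forall x y z,
  w (br x y) z + w (br y z) x + w (br z x) y = 0.

Definition pseudo_kahler br J g : Prop :=
  [/\ almost_pseudo_hermitian J g,
      integrable br J
    & closed_form br (fundamental_form J g)].

(* h_0 = h^perp + J h^perp *)
Definition hzero J g (h : {vspace L}) : {vspace L} :=
  (orthov g h + J @: orthov g h)%VS.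

Definition isotropic g (U : {vspace L}) : Prop :=
  {in U &, forall x y, g x y = 0}.

End PseudoKahler.

(* Basis vectors and dual covectors are numbered from 1, while tuples and
   ordinals are numbered from 0. *)
Section Bases.
Variables (R : fieldType) (L : vectType R) (N : nat) (e : N.-tuple L).

Definition bvec (i : nat) : L := e`_i.-1.

Definition bcovec (i : nat) (x : L) : R :=
  oapp (fun k : 'I_N => coord e k x) 0 (insub i.-1).

(* Span{e_i, ..., e_j}, both ends included; 0 if j < i. *)
Definition bspan (i j : nat) : {vspace L} :=
  <<[seq bvec k | k <- index_iota i j.+1]>>%VS.

End Bases.

Section Tensors.
Variables (R : fieldType) (L : vectType R).
Implicit Types a b : L -> R.

Definition tens a b : L -> L -> R := fun x y => a x * b y.
Definition odot a b : L -> L -> R := fun x y => tens a b x y + tens b a x y.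

End Tensors.

Section BlockForm.
Variables (R : fieldType) (L : vectType R) (h V : {vspace L}) (p q r : L).

(* The vector of Span{p} + Span{q} + V + Span{r} with components
   (x1, x2, u, y). *)
Definition col4 (x1 x2 : R) (u : subvs_of V) (y : R) : L :=
  x1 *: p + x2 *: q + vsval u + y *: r.

(* D is given, in the decomposition h = Span{p} + Span{q} + V + Span{r}, by
       | -a   0   -(J v)^flat   c1 |
       |  0  -a      v^flat     c2 |
       |  0   0         A        v |
       |  0   0         0        a |
   acting on columns (x1, x2, u, y). *)
Definition has_block_matrix (D : 'End(subvs_of h))
    (JV : 'End(subvs_of V)) (gV : subvs_of V -> subvs_of V -> R)
    (A : 'End(subvs_of V)) (v : subvs_of V) (a c1 c2 : R) : Prop :=
  forall (x : subvs_of h) (x1 x2 : R) (u : subvs_of V) (y : R),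
    vsval x = col4 x1 x2 u y ->
    vsval (D x) = col4 (- a * x1 - flat gV (JV v) u + c1 * y)
                       (- a * x2 + flat gV v u + c2 * y)
                       (A u + y *: v)
                       (a * y).

End BlockForm.

(* Main.v *)
Require Import Defs.
From HB Require Import structures.
From mathcomp Require Import all_boot all_order all_algebra.
From mathcomp Require Import reals ring zify.

Set Implicit Arguments.
Unset Strict Implicit.
Unset Printing Implicit Defensive.

Import Order.TTheory GRing.Theory Num.Theory.
Local Open Scope ring_scope.

(** Write T for ad(e_2n) and theta for the linear form g(., e_1), whose kernel
    is h.  Since h is abelian, the whole bracket is recovered from T:
      [x, y] = theta(x) T y - theta(y) T x      (almost_abelian_bracketE).
    Hence both defining conditions become conditions on T restricted to h:
    - J is integrable iff T commutes with J on the J-invariant hyperplane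
      h :&: J h of h                             (integrable_commute);
    - omega = g(J ., .) is closed iff T is infinitesimally symplectic for the
      restriction of omega to h                  (closed_symplectic).
    The restriction of omega to h is degenerate: its kernel is J h^perp.

    The second half is linear algebra in a Witt frame p, q = Jp, r, s = Jr
    (that is, e_1, e_2, e_(2n-1), e_2n): p and s, and q and r, are dual null
    pairs up to sign, and V is the orthogonal complement of the four of them.
    If T satisfies both conditions, it preserves the kernel of omega on h, so
    q is an eigenvector, and so is p = - J q by commutation.  The relations
    omega(Tx, y) + omega(x, Ty) = 0 on the pairs (p, r), (u, r), (u, u') with
    u, u' in V then give in turn the eigenvalue - a, the first row
    - (J v)^flat, and the skewness of A; commutation with J turns the first row
    into the second and makes A complex linear        (block_form_exists).
    Conversely, a matrix of this shape satisfies both conditions by inspection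
    (block_form_commute, block_form_symplectic). *)

(** * Linear identities *)

(** Reduces an identity between linear combinations of vectors to a scalar
    identity, which [ring] can decide. *)
Lemma eq_vect_scalar (R : fieldType) (L : vectType R) (x y : L) :
  (forall f : {scalar L}, f x = f y) -> x = y.
Proof.
move=> fE; rewrite (coord_vbasis (memvf x)) (coord_vbasis (memvf y)).
by apply: eq_bigr => i _; congr (_ *: _); apply: (fE (coord (vbasis fullv) i)).
Qed.

Lemma scalar_lin (R : fieldType) (L : vectType R) (f : {scalar L}) :
  ((forall x y, f (x + y) = f x + f y)%R * (forall x, f (- x) = - f x)%R *
   (forall a x, f (a *: x) = a * f x)%R * (f 0 = 0)%R)%type.
Proof. by do !split=> *; rewrite ?linearD ?linearN ?linearZ ?linear0. Qed.

Lemma end_lin (R : fieldType) (L : vectType R) (f : 'End(L)) :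
  ((forall x y, f (x + y) = f x + f y)%R * (forall x, f (- x) = - f x)%R *
   (forall a x, f (a *: x) = a *: f x)%R * (f 0 = 0)%R)%type.
Proof. by do !split=> *; rewrite ?linearD ?linearN ?linearZ ?linear0. Qed.

(** To deduce an equation from another one, it suffices that the differences of
    their two sides agree: the form in which [ring] can use a hypothesis. *)
Lemma eq_transfer (V : zmodType) (a b c d : V) :
  a = b -> c - d = a - b -> c = d.
Proof. by move=> ->; rewrite subrr => /subr0_eq. Qed.

Section SymmetricForm.
Variables (R : fieldType) (L : vectType R) (g : {symmetric L}).

Lemma formC x y : g x y = g y x.
Proof. by rewrite hermC expr0 mul1r. Qed.
Lemma formDl x y z : g (x + y) z = g x z + g y z. Proof. exact: linearDl. Qed.
Lemma formDr x y z : g z (x + y) = g z x + g z y. Proof. exact: linearDr. Qed.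
Lemma formNl x z : g (- x) z = - g x z. Proof. exact: linearNl. Qed.
Lemma formNr x z : g z (- x) = - g z x. Proof. exact: linearNr. Qed.
Lemma formZl a x z : g (a *: x) z = a * g x z. Proof. exact: linearZl_LR. Qed.
Lemma formZr a x z : g z (a *: x) = a * g z x. Proof. exact: linearZr_LR. Qed.
Lemma form0l z : g 0 z = 0. Proof. exact: linear0l. Qed.
Lemma form0r z : g z 0 = 0. Proof. exact: linear0r. Qed.

Definition form_lin :=
  (formDl, formDr, formNl, formNr, formZl, formZr, form0l, form0r).
End SymmetricForm.

(** * Integrability and closedness on an almost abelian Lie algebra *)

Section AlmostAbelianBracket.
Variables (R : fieldType) (L : vectType R) (br : {bilinear L -> L -> L}).
Variables (h : {vspace L}) (J : 'End(L)) (g : {symmetric L}) (p r s : L).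

Hypothesis br_alt : forall x, br x x = 0.
Hypothesis br_abel : {in h &, forall x y, br x y = 0}.
Hypothesis mem_h : forall x, (x \in h) = (g x p == 0).
Hypothesis g_s_p : g s p = 1.

Local Notation T := (ad br s).

Lemma br_skew x y : br x y = - br y x.
Proof.
apply/eqP; rewrite -addr_eq0; apply/eqP.
by have := br_alt (x + y); rewrite linearDl/= !linearDr/= !br_alt add0r addr0.
Qed.

(** Both x - g(x,p) s and y - g(y,p) s lie in the abelian hyperplane h, so their
    bracket vanishes; expanding it gives the formula. *)
Lemma almost_abelian_bracketE x y : br x y = g x p *: T y - g y p *: T x.
Proof.
have hproj z : z - g z p *: s \in h.
  by rewrite mem_h !form_lin g_s_p mulr1 subrr.
have := br_abel (hproj x) (hproj y).
rewrite /ad !lfunE/= linearBl/= !linearBr/= !linearZl_LR/= !linearZr_LR/=.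
rewrite br_alt (br_skew x s) => H.
apply: (eq_transfer H); apply: eq_vect_scalar => f.
rewrite !(scalar_lin f); ring.
Qed.

Hypothesis JJ : forall x, J (J x) = - x.
Hypothesis Jr : J r = s.
Hypothesis g_r_p : g r p = 0.

Lemma T_s : T s = 0. Proof. by rewrite /ad lfunE/= br_alt. Qed.

Lemma Js : J s = - r. Proof. by rewrite -Jr JJ. Qed.

(** For x in h :&: J h the Nijenhuis tensor at (s, x) is T x + J T J x, that is,
    J (T J x - J T x), which gives one direction.  For the other one,
    S = J T - T J vanishes on h :&: J h and satisfies S s = T r, S r = J T r, so
    S has rank at most two and the Nijenhuis tensor, a combination of S and J S
    with coefficients in g(., p) and g(J ., p), cancels. *)
Lemma integrable_commute :
  integrable br J <->
  (forall x, x \in h -> J x \in h -> T (J x) = J (T x)).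
Proof.
split=> [Hint x | Hcom x y].
  rewrite !mem_h => /eqP gxp /eqP gJxp; have := Hint s x.
  rewrite !almost_abelian_bracketE Js formNl g_s_p g_r_p gxp gJxp oppr0.
  rewrite !scale1r !scale0r !subr0 linear0 addr0 => H.
  have := congr1 J H; rewrite linearD/= JJ linear0 => /eqP.
  by rewrite subr_eq0 => /eqP.
pose S z := J (T z) - T (J z).
have SE z : S z = g z p *: T r + g (J z) p *: J (T r).
  (* z = z0 + theta(z) s + theta(J z) r with z0 in h :&: J h *)
  have: z - g z p *: s - g (J z) p *: r \in h.
    by rewrite mem_h !form_lin g_s_p g_r_p mulr1 mulr0 subrr oppr0 addr0.
  move/Hcom.
  have -> : J (z - g z p *: s - g (J z) p *: r) =
    J z + g z p *: r - g (J z) p *: s.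
    by rewrite !(end_lin J) Jr Js !(scalerN, opprK).
  rewrite mem_h !form_lin g_s_p g_r_p mulr1 mulr0 addr0 subrr eqxx => /(_ isT).
  rewrite !(end_lin T) !(end_lin J) T_s => H.
  rewrite /S; apply: (eq_transfer (esym H)); apply: eq_vect_scalar => f.
  by rewrite !(scalar_lin f); ring.
have TJE z : T (J z) = J (T z) - S z by rewrite /S subKr.
rewrite !almost_abelian_bracketE !TJE !SE !(end_lin J) !JJ.
apply: eq_vect_scalar => f; rewrite !(scalar_lin f); ring.
Qed.

Let w := fundamental_form J g.

Lemma fundamental_skew (gJ : forall x y, g (J x) (J y) = g x y) x y :
  w x y = - w y x.
Proof. by rewrite /w /fundamental_form -gJ JJ formNl formC. Qed.

(** With B(y, z) = w(T y, z) + w(y, T z), the bracket formula makes dw(x, y, z)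
    the cyclic sum of theta(x) B(y, z); taking x = s and y, z in h isolates
    B(y, z).  Conversely, if B vanishes on h then
    B(y, z) = theta(z) b(y) - theta(y) b(z) for b = B(., s), and the cyclic sum
    vanishes for every such B. *)
Lemma closed_symplectic (gJ : forall x y, g (J x) (J y) = g x y) :
  closed_form br w <-> {in h &, forall x y, w (T x) y + w x (T y) = 0}.
Proof.
have wE x y z : w (br x y) z = g x p * w (T y) z - g y p * w (T x) z.
  rewrite /w /fundamental_form almost_abelian_bracketE !(end_lin J).
  by rewrite !form_lin.
have skew := fundamental_skew gJ.
split=> [Hcl x y | Hsym].
  move=> hx hy; move: (hx) (hy); rewrite !mem_h => /eqP gxp /eqP gyp.
  have := Hcl s x y.
  by rewrite !wE g_s_p gxp gyp (skew x) => <-; ring.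
pose B y z := w (T y) z + w y (T z).
have BE y z : B y z = g z p * B y s - g y p * B z s.
  have hproj u : u - g u p *: s \in h.
    by rewrite mem_h !form_lin g_s_p mulr1 subrr.
  have := Hsym _ _ (hproj y) (hproj z).
  rewrite /B (skew (T z) s) /w /fundamental_form !(end_lin T) !(end_lin J) T_s.
  rewrite (end_lin J) !form_lin.
  by move=> H; apply: (eq_transfer H); ring.
move=> x y z; rewrite !wE.
transitivity (g x p * B y z + g y p * B z x + g z p * B x y).
  rewrite /B (skew z (T x)) (skew x (T y)) (skew y (T z)); ring.
rewrite (BE y z) (BE z x) (BE x y); ring.
Qed.
End AlmostAbelianBracket.

(** * Endomorphisms in a Witt frame *)

Section WittFrame.
Variables (R : fieldType) (L : vectType R).

(** The products not listed, such as g q r = -1, follow from the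
    J-invariance of g.
    Describing h and V by orthogonality keeps bases out of the argument, and
    makes the J-invariance of V a consequence. *)
Record witt_frame (h V : {vspace L}) (J : 'End(L)) (g : {symmetric L})
    (p q r s : L) : Prop := WittFrame {
  frame_Jp : J p = q;
  frame_Jr : J r = s;
  frame_pp : g p p = 0;
  frame_pq : g p q = 0;
  frame_pr : g p r = 0;
  frame_ps : g p s = 1;
  frame_rr : g r r = 0;
  frame_rs : g r s = 0;
  frame_h : forall x, (x \in h) = (g x p == 0);
  frame_V : forall x,
    (x \in V) = [&& g x p == 0, g x q == 0, g x r == 0 & g x s == 0]
}.

Variables (h V : {vspace L}) (J : 'End(L)) (g : {symmetric L}) (p q r s : L).
Hypothesis frame : witt_frame h V J g p q r s.
Hypothesis JJ : forall x, J (J x) = - x.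
Hypothesis gJ : forall x y, g (J x) (J y) = g x y.

Local Notation JV := (restr_end V J).
Local Notation gV := (@restr_form R L V g).
Local Notation w := (fundamental_form J g).
Local Notation col := (@col4 R L V p q r).

Lemma frame_Jq : J q = - p. Proof. by rewrite -(frame_Jp frame) JJ. Qed.
Lemma frame_Js : J s = - r. Proof. by rewrite -(frame_Jr frame) JJ. Qed.
Lemma frame_qq : g q q = 0.
Proof. by rewrite -(frame_Jp frame) gJ (frame_pp frame). Qed.
Lemma frame_qs : g q s = 0.
Proof. by rewrite -(frame_Jp frame) -(frame_Jr frame) gJ (frame_pr frame). Qed.
Lemma frame_qr : g q r = -1.
Proof.
by rewrite -(frame_ps frame) -(gJ p s) (frame_Jp frame) frame_Js formNr opprK.
Qed.
Lemma frame_ss : g s s = 0.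
Proof. by rewrite -(frame_Jr frame) gJ (frame_rr frame). Qed.

Let table := (frame_pp frame, frame_pq frame, frame_pr frame, frame_ps frame,
  frame_rr frame, frame_rs frame, frame_qq, frame_qs, frame_qr, frame_ss).
Let gE := (table, formC g q p, formC g r p, formC g s p, formC g r q,
  formC g s q, formC g s r, table).

Lemma form_J x y : g (J x) y = - g x (J y).
Proof. by rewrite -gJ JJ formNl. Qed.

Lemma frame_V_perp u : u \in V ->
  [/\ g u p = 0, g u q = 0, g u r = 0 & g u s = 0].
Proof. by rewrite (frame_V frame) => /and4P[/eqP? /eqP? /eqP? /eqP?]. Qed.

Lemma frame_V_sub_h u : u \in V -> u \in h.
Proof. by rewrite (frame_h frame) => /frame_V_perp[-> _ _ _]. Qed.

Lemma frame_J_V u : u \in V -> J u \in V.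
Proof.
move=> /frame_V_perp[up uq ur us]; rewrite (frame_V frame) !form_J.
rewrite (frame_Jp frame) (frame_Jr frame) frame_Jq frame_Js !formNr.
by rewrite up uq ur us !oppr0 eqxx.
Qed.

Lemma val_JV (u : subvs_of V) : vsval (JV u) = J (vsval u).
Proof. by rewrite !comp_lfunE !lfunE/= vsprojK// frame_J_V// subvsP. Qed.

(** The orthogonal projection onto V: subtract the components along the frame,
    which are read off from the products with the dual frame vectors. *)
Definition witt_proj (x : L) : L :=
  x - (g x s *: p - g x r *: q - g x q *: r + g x p *: s).

Fact witt_proj_is_linear : linear witt_proj.
Proof.
move=> a x y; rewrite /witt_proj !form_lin; apply: eq_vect_scalar => f.
by rewrite !(scalar_lin f); ring.
Qed.
HB.instance Definition _ :=
  GRing.isLinear.Build R L L *:%R witt_proj witt_proj_is_linear.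

Lemma witt_proj_V x : witt_proj x \in V.
Proof.
rewrite (frame_V frame) /witt_proj !form_lin !gE.
by apply/and4P; split; apply/eqP; ring.
Qed.

Lemma witt_decomp x : x \in h ->
  x = g x s *: p - g x r *: q + witt_proj x - g x q *: r.
Proof.
rewrite (frame_h frame) /witt_proj => /eqP ->; rewrite scale0r addr0.
apply: eq_vect_scalar => f; rewrite !(scalar_lin f); ring.
Qed.

Lemma witt_proj_J x : witt_proj (J x) = J (witt_proj x).
Proof.
rewrite /witt_proj !(end_lin J) !form_J.
rewrite (frame_Jp frame) (frame_Jr frame) frame_Jq frame_Js !formNr.
apply: eq_vect_scalar => f; rewrite !(scalar_lin f); ring.
Qed.

Lemma form_witt_proj x u : u \in V -> g (witt_proj x) u = g x u.
Proof.
move=> /frame_V_perp[up uq ur us].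
rewrite /witt_proj !form_lin !(formC _ _ u) up uq ur us; ring.
Qed.

Lemma col4_h x1 x2 u y : col x1 x2 u y \in h.
Proof.
have [up _ _ _] := frame_V_perp (subvsP u).
by rewrite (frame_h frame) /col4 !form_lin !gE up !mulr0 !addr0.
Qed.

Lemma h_col4 x : x \in h -> exists x1 x2 u y, x = col x1 x2 u y.
Proof.
move=> hx; exists (g x s), (- g x r), (vsproj V (witt_proj x)), (- g x q).
by rewrite /col4 vsprojK ?witt_proj_V// !scaleNr; exact: witt_decomp.
Qed.

Lemma J_col4 x1 x2 u : J (col x1 x2 u 0) = col (- x2) x1 (JV u) 0.
Proof.
rewrite /col4 !(end_lin J) (frame_Jp frame) frame_Jq val_JV !scale0r.
by rewrite !addr0 scalerN scaleNr (addrC (_ *: q)).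
Qed.

Lemma fundamental_col4 x1 x2 u y x1' x2' u' y' :
  w (col x1 x2 u y) (col x1' x2' u' y') =
    y * x1' - x1 * y' + w (vsval u) (vsval u').
Proof.
have [up uq ur us] := frame_V_perp (frame_J_V (subvsP u)).
have [vp vq vr vs] := frame_V_perp (subvsP u').
rewrite /fundamental_form /col4 !(end_lin J).
rewrite (frame_Jp frame) frame_Jq (frame_Jr frame) !form_lin !gE.
rewrite up uq ur (formC _ p) (formC _ q) (formC _ s) vp vq vs; ring.
Qed.

Variable T : 'End(L).
Hypothesis T_h : forall x, x \in h -> T x \in h.

Lemma valDZ (z z' : subvs_of V) b :
  vsval (z + b *: z') = vsval z + b *: vsval z'.
Proof. by rewrite linearD linearZ. Qed.

(** The block matrix describes T itself: since T preserves h, restricting it to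
    an endomorphism of h loses nothing. *)
Lemma has_block_matrixP A v a c1 c2 :
  has_block_matrix p q r (restr_end h T) JV gV A v a c1 c2 <->
  forall x1 x2 u y, T (col x1 x2 u y) =
    col (- a * x1 - flat gV (JV v) u + c1 * y)
        (- a * x2 + flat gV v u + c2 * y) (A u + y *: v) (a * y).
Proof.
have val_D x : vsval (restr_end h T x) = T (vsval x).
  by rewrite !comp_lfunE !lfunE/= vsprojK// T_h// subvsP.
split=> [Hb x1 x2 u y | Hb x x1 x2 u y xE]; last by rewrite val_D xE Hb.
by rewrite -(Hb (vsproj h (col x1 x2 u y))) ?val_D vsprojK ?col4_h.
Qed.

(** An element of h with J x in h has no component along r, so only the first
    three columns of the matrix matter; J exchanges the first two rows up to
    sign and (J v)^flat with v^flat. *)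
Lemma block_form_commute A v a c1 c2 :
  unitary_lie JV gV A ->
  has_block_matrix p q r (restr_end h T) JV gV A v a c1 c2 ->
  forall x, x \in h -> J x \in h -> T (J x) = J (T x).
Proof.
move=> [AJ _] /has_block_matrixP TE x /h_col4[x1 [x2 [u [y ->]]]].
rewrite (frame_h frame) form_J (frame_Jp frame) => /eqP.
have [_ uq _ _] := frame_V_perp (subvsP u).
rewrite /col4 !form_lin !gE uq -/(col _ _ _ _) => yE.
have -> : y = 0 by rewrite -[RHS]yE; ring.
rewrite J_col4 !TE !mulr0 !scale0r !addr0 J_col4.
have -> : A (JV u) = JV (A u) by have /lfunP/(_ u) := AJ; rewrite !comp_lfunE.
rewrite /flat /restr_form !val_JV gJ form_J opprK; congr col4; ring.
Qed.

(** On h, w is r^* /\ p^* plus its restriction to V, where p^*, r^* are the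
    coordinates along p and r.  The diagonal - a, a cancels on the first
    summand, A contributes nothing because it is symplectic on V, and the row
    - (J v)^flat cancels the column v. *)
Lemma block_form_symplectic A v a c1 c2 :
  unitary_lie JV gV A ->
  has_block_matrix p q r (restr_end h T) JV gV A v a c1 c2 ->
  {in h &, forall x y, w (T x) y + w x (T y) = 0}.
Proof.
move=> [AJ A_skew] /has_block_matrixP TE x x'.
move=> /h_col4[x1 [x2 [u [y ->]]]] /h_col4[x1' [x2' [u' [y' ->]]]].
rewrite !TE !fundamental_col4.
have AE : w (vsval (A u)) (vsval u') = - w (vsval u) (vsval (A u')).
  (* skewness of A for g at J u becomes skewness for w at u *)
  have := A_skew (JV u) u'.
  have -> : A (JV u) = JV (A u) by have /lfunP/(_ u) := AJ; rewrite !comp_lfunE.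
  by rewrite /restr_form !val_JV.
rewrite /flat /restr_form val_JV.
rewrite (_ : w (vsval (A u + y *: v)) (vsval u') =
   w (vsval (A u)) (vsval u') + y * w (vsval v) (vsval u')); last first.
  by rewrite /fundamental_form valDZ !(end_lin J) !form_lin.
rewrite (_ : w (vsval u) (vsval (A u' + y' *: v)) =
   w (vsval u) (vsval (A u')) - y' * w (vsval v) (vsval u)); last first.
  rewrite /fundamental_form valDZ !form_lin (form_J (vsval u) (vsval v)).
  by rewrite (formC _ (vsval u) (J _)) mulrN.
rewrite AE /fundamental_form; ring.
Qed.

Hypothesis h_perp : orthov g h = <[p]>%VS.
Hypothesis T_commute : forall x, x \in h -> J x \in h -> T (J x) = J (T x).
Hypothesis T_sympl : {in h &, forall x y, w (T x) y + w x (T y) = 0}.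

Let v := witt_proj (T r).
Let a := - g (T r) q.

Let hp : p \in h. Proof. by rewrite (frame_h frame) !gE eqxx. Qed.
Let hq : q \in h. Proof. by rewrite (frame_h frame) !gE eqxx. Qed.
Let hr : r \in h. Proof. by rewrite (frame_h frame) !gE eqxx. Qed.

(** The vector q spans the kernel of w on h, so J (T q) is orthogonal to h,
    hence proportional to p; the pair (p, r) identifies the eigenvalue. *)
Lemma block_form_pq : T p = - a *: p /\ T q = - a *: q.
Proof.
have /vlineP[k kE] : J (T q) \in <[p]>%VS.
  rewrite -h_perp; apply/mem_orthovP => y hy; have := T_sympl hq hy.
  have := T_h hy; rewrite (frame_h frame) => /eqP Ty.
  by rewrite /fundamental_form frame_Jq formNl (formC _ p) Ty oppr0 addr0.
have Tq : T q = - k *: q.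
  by rewrite -[LHS]opprK -(JJ (T q)) kE linearZ/= (frame_Jp frame) scaleNr.
have Tp : T p = - k *: p.
  have := T_commute hq; rewrite frame_Jq kE linearN/=.
  by rewrite rpredN => /(_ hp) /(congr1 -%R); rewrite opprK scaleNr.
suff -> : a = k by [].
have := T_sympl hp hr; rewrite /fundamental_form (frame_Jp frame) Tp linearZ/=.
rewrite (frame_Jp frame) !form_lin !gE (formC _ q) /a => E.
by apply: (eq_transfer (esym E)); ring.
Qed.

(** The component along p comes from w(T u, r) + w(u, T r) = 0; the one along q
    is minus the component along p for J u, as T commutes with J at u; there is
    none along r, as T u lies in h :&: J h. *)
Lemma block_form_V u : u \in V ->
  T u = - g (J v) u *: p + g v u *: q + witt_proj (T u).
Proof.
move=> Vu; have hu := frame_V_sub_h Vu; have VJu := frame_J_V Vu.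
have hJu := frame_V_sub_h VJu; have TJ := T_commute hu hJu.
have s_comp z : z \in V -> g (T z) s = - g (J v) z.
  move=> Vz; have := T_sympl (frame_V_sub_h Vz) hr.
  rewrite /fundamental_form form_J (frame_Jr frame) => E.
  rewrite form_J form_witt_proj ?frame_J_V// opprK (formC _ (T r)).
  by apply: (eq_transfer (esym E)); ring.
have r_comp : g (T u) r = - g v u.
  have := s_comp _ VJu; rewrite TJ form_J frame_Js gJ formNr opprK.
  exact.
have q_comp : g (T u) q = 0.
  have := T_h hJu; rewrite TJ (frame_h frame) form_J (frame_Jp frame).
  by rewrite oppr_eq0 => /eqP.
rewrite {1}(witt_decomp (T_h hu)) s_comp// r_comp q_comp.
by rewrite scale0r subr0 !scaleNr opprK.
Qed.

(** The last column is T r read in the frame, which defines v, a, c1 and c2, and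
    A is the compression of T to V; [block_form_pq] and [block_form_V] express
    the other columns in terms of these. *)
Lemma block_form_exists :
  exists (A : 'End(subvs_of V)) (v : subvs_of V) (a c1 c2 : R),
    unitary_lie JV gV A /\
    has_block_matrix p q r (restr_end h T) JV gV A v a c1 c2.
Proof.
pose A := restr_end V (linfun witt_proj \o T)%VF.
have val_A u : vsval (A u) = witt_proj (T (vsval u)).
  by rewrite !comp_lfunE !lfunE/= vsprojK ?witt_proj_V.
exists A, (vsproj V v), a, (g (T r) s), (- g (T r) r); split.
  split=> [|x y].
    apply/lfunP => u; apply: subvs_inj.
    rewrite (comp_lfunE A JV u) (comp_lfunE JV A u) val_A !val_JV val_A.
    have Vu := subvsP u.
    rewrite T_commute ?witt_proj_J//; apply: frame_V_sub_h => //.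
    exact: frame_J_V.
  have Vx := subvsP x; have Vy := subvsP y.
  have hx := frame_V_sub_h Vx; have hJy := frame_V_sub_h (frame_J_V Vy).
  have hy := frame_V_sub_h Vy.
  rewrite /restr_form !val_A form_witt_proj// (formC _ _ (witt_proj _)).
  rewrite form_witt_proj// (formC _ (T (vsval y))).
  (* closedness at (x, J y), after moving J through T *)
  have := T_sympl hx hJy; rewrite /fundamental_form T_commute// !gJ.
  by move=> E; apply: (eq_transfer E); ring.
have [Tp Tq] := block_form_pq.
apply/has_block_matrixP => x1 x2 u y.
rewrite /col4 !(end_lin T) Tp Tq (block_form_V (subvsP u)) valDZ val_A.
rewrite {1}(witt_decomp (T_h hr)) /flat /restr_form val_JV.
rewrite vsprojK ?witt_proj_V// -/v /a.
apply: eq_vect_scalar => f; rewrite !(scalar_lin f); ring.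
Qed.

End WittFrame.

(** * From an adapted basis to a Witt frame *)

Section AdaptedBasis.
Variables (R : fieldType) (L : vectType R) (N : nat) (e : N.-tuple L).
Hypothesis He : basis_of {:L} e.

Lemma bcovec_is_scalar k : scalar (bcovec e k).
Proof.
move=> a x y; rewrite /bcovec; case: insub => [i|] /=; last first.
  by rewrite mulr0 addr0.
by rewrite linearP.
Qed.
HB.instance Definition _ k :=
  GRing.isLinear.Build R L R *%R (bcovec e k) (bcovec_is_scalar k).

Lemma bcovec_bvec i j : (0 < i <= N)%N -> (0 < j <= N)%N ->
  bcovec e i (bvec e j) = (i == j)%:R.
Proof.
case: i j => [|i] [|j]//= iN jN; rewrite /bcovec/= insubT /bvec/=.
rewrite (coord_free (Ordinal jN) (Ordinal iN) (basis_free He) : _ = _).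
by rewrite eqSS eq_sym.
Qed.

Lemma bspan_bvec i j k : (i <= k <= j)%N -> bvec e k \in bspan e i j.
Proof. by move=> ikj; rewrite memv_span// map_f// mem_index_iota ltnS. Qed.

Lemma bvec_basis x : x = \sum_(1 <= k < N.+1) bcovec e k x *: bvec e k.
Proof.
rewrite big_add1 big_mkord {1}(coord_basis He (memvf x)).
apply: eq_bigr => i _; rewrite /bcovec/= insubT//= => iN.
by congr (coord e _ x *: _); apply: val_inj.
Qed.

Lemma mem_bspanP i j x : (0 < i)%N -> (j <= N)%N ->
  reflect (forall k, (0 < k <= N)%N -> ~~ (i <= k <= j)%N -> bcovec e k x = 0)
          (x \in bspan e i j).
Proof.
move=> i0 jN; apply: (iffP idP) => [xs k kN kij | x0].
  have: (bspan e i j <= lker (linfun (bcovec e k : L -> R^o)))%VS.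
    apply/span_subvP => u /mapP[l]; rewrite mem_index_iota ltnS.
    move=> /andP[il lj] ->.
    rewrite memv_ker lfunE/= bcovec_bvec//; last first.
      by rewrite (leq_trans i0 il) (leq_trans lj).
    by move: kij; have [->|_ _] := eqVneq k l; rewrite ?il ?lj ?eqxx.
  by move/subvP/(_ _ xs); rewrite memv_ker lfunE => /eqP.
rewrite (bvec_basis x) big_seq rpred_sum// => k.
rewrite mem_index_iota ltnS => kN.
have [kij | kij] := boolP (i <= k <= j)%N; first by rewrite rpredZ// bspan_bvec.
by rewrite x0// scale0r mem0v.
Qed.

End AdaptedBasis.

(** In the plane the two hyperbolic terms are the same and cancel, so g = 0. *)
Lemma split_form_gt1 (R : fieldType) (L : vectType R) (n : nat)
  (e : (2 * n).-tuple L) (g : {symmetric L}) (eps : nat -> R)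
  (He : basis_of {:L} e) (n_gt0 : (0 < n)%N) (nondeg : nondegenerate g)
  (Heg : forall x y, g x y =
     odot (bcovec e 1) (bcovec e (2 * n)) x y
     - odot (bcovec e 2) (bcovec e (2 * n - 1)) x y
     + \sum_(3 <= i < (2 * n - 2).+1)
         eps i * tens (bcovec e i) (bcovec e i) x y) :
  (1 < n)%N.
Proof.
rewrite ltn_neqAle n_gt0 andbT; apply/eqP => n1; subst n.
have e10 : bvec e 1 \in orthov g fullv.
  apply/mem_orthovP => y _; rewrite Heg big_geq// addr0.
  by rewrite /odot /tens/=; ring.
have := bcovec_bvec He (isT : 0 < 1 <= 2 * 1)%N (isT : 0 < 1 <= 2 * 1)%N.
move: e10; rewrite (eqP nondeg) memv0 => /eqP ->; rewrite linear0.
by move/esym/eqP; rewrite oner_eq0.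
Qed.

(** Pairing with e_1, e_2, e_(2n-1), e_2n reads off, up to sign, the coordinates
    number 2n, 2n-1, 2, 1; so h and V, which are spanned by basis vectors and
    hence cut out by coordinates, are cut out by these pairings. *)
Lemma basis_witt_frame (R : fieldType) (L : vectType R) (n : nat)
  (e : (2 * n).-tuple L) (J : 'End(L)) (g : {symmetric L}) (eps : nat -> R)
  (He : basis_of {:L} e) (n_gt1 : (1 < n)%N)
  (HeJ : forall i, (1 <= i <= n)%N -> J (bvec e (2 * i - 1)) = bvec e (2 * i))
  (Heg : forall x y, g x y =
     odot (bcovec e 1) (bcovec e (2 * n)) x y
     - odot (bcovec e 2) (bcovec e (2 * n - 1)) x y
     + \sum_(3 <= i < (2 * n - 2).+1)
         eps i * tens (bcovec e i) (bcovec e i) x y) :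
  witt_frame (bspan e 1 (2 * n - 1)) (bspan e 3 (2 * n - 2)) J g
    (bvec e 1) (bvec e 2) (bvec e (2 * n - 1)) (bvec e (2 * n)).
Proof.
set p := bvec e 1; set q := bvec e 2; set r := bvec e (2 * n - 1).
set s := bvec e (2 * n).
have gE x j : (0 < j <= 2 * n)%N -> ~~ (3 <= j <= 2 * n - 2)%N ->
    g x (bvec e j) =
      bcovec e 1 x * (j == 2 * n)%N%:R + bcovec e (2 * n) x * (j == 1)%N%:R
      - (bcovec e 2 x * (j == 2 * n - 1)%N%:R
         + bcovec e (2 * n - 1) x * (j == 2)%N%:R).
  move=> jN jmid; rewrite Heg big_nat_cond big1 ?addr0 => [|i].
    rewrite /odot /tens !bcovec_bvec//; try lia.
    by rewrite !(eq_sym j); ring.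
  (* no middle covector sees e_j, so the sum over V drops out *)
  rewrite andbT ltnS => imid; rewrite /tens bcovec_bvec//; last lia.
  by case: eqP => [ij|]; [move: jmid; rewrite -ij imid | rewrite !mulr0].
have far : [/\ (1 == 2 * n)%N = false, (1 == 2 * n - 1)%N = false,
    (2 == 2 * n)%N = false & (2 == 2 * n - 1)%N = false].
  by split; apply/eqP; lia.
have [far1 far1' far2 far2'] := far.
have last_neq : (2 * n == 2 * n - 1)%N = false by apply/eqP; lia.
have gp x : g x p = bcovec e (2 * n) x.
  have := gE x 1%N; rewrite far1 far1' !eqxx.
  by move=> ->; [rewrite /=; ring | lia | lia].
have gq x : g x q = - bcovec e (2 * n - 1) x.
  have := gE x 2; rewrite far2 far2' eqxx.
  by move=> ->; [rewrite /=; ring | lia | lia].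
have gr x : g x r = - bcovec e 2 x.
  have := gE x (2 * n - 1)%N.
  rewrite eqxx [(_ == 2 * n)%N]eq_sym last_neq.
  rewrite ![(2 * n - 1 == _)%N]eq_sym far1' far2'.
  by move=> ->; [rewrite /=; ring | lia | lia].
have gs x : g x s = bcovec e 1 x.
  have := gE x (2 * n)%N.
  rewrite eqxx last_neq ![(2 * n == _)%N]eq_sym far1 far2.
  by move=> ->; [rewrite /=; ring | lia | lia].
have bE i j : (0 < i <= 2 * n)%N -> (0 < j <= 2 * n)%N -> i <> j ->
    bcovec e i (bvec e j) = 0.
  by move=> iN jN /eqP/negPf ij; rewrite bcovec_bvec// ij.
split.
- by apply: (HeJ 1%N); lia.
- by apply: HeJ; lia.
- by rewrite gp bE//; lia.
- by rewrite gq bE ?oppr0//; lia.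
- by rewrite gr bE ?oppr0//; lia.
- by rewrite gs bcovec_bvec//; lia.
- by rewrite gr bE ?oppr0//; lia.
- by rewrite gs bE//; lia.
- move=> x; have hP := @mem_bspanP _ _ _ _ He 1 _ x isT (leq_subr 1 (2 * n)).
  rewrite gp; apply/idP/eqP => [/hP|xN]; first by apply; lia.
  apply/hP => k kN kh; have -> : k = (2 * n)%N by lia.
  exact: xN.
- move=> x; have VP := @mem_bspanP _ _ _ _ He 3 _ x isT (leq_subr 2 (2 * n)).
  rewrite gp gq gr gs !oppr_eq0; apply/idP/and4P => [/VP x0|].
    by split; apply/eqP; apply: x0; lia.
  move=> [/eqP x1 /eqP x2 /eqP x3 /eqP x4]; apply/VP => k kN kV.
  have : (k = 2 * n \/ k = 2 * n - 1 \/ k = 2 \/ k = 1)%N by lia.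
  by case=> [|[|[]]] ->.
Qed.

(** * The characterization *)

Theorem proposition1p2 (R : realType) (n : nat) (L : vectType R)
  (br : {bilinear L -> L -> L}) (h V : {vspace L})
  (J : 'End(L)) (g : {symmetric L})
  (e : (2 * n).-tuple L) (eps : nat -> R) (D : 'End(subvs_of h))
  (Hdim : \dim {:L} = (2 * n)%N)
  (Hlie : is_lie_bracket br)
  (Hh : codim1_abelian_ideal br h)
  (HJg : almost_pseudo_hermitian J g)
  (Hiso : isotropic g (hzero J g h))
  (He : basis_of {:L} e)
  (Heh : h = bspan e 1 (2 * n - 1))
  (Hehperp : orthov g h = <[bvec e 1]>%VS)
  (HD : D = restr_end h (ad br (bvec e (2 * n))))
  (HeJ : forall i, (1 <= i <= n)%N -> J (bvec e (2 * i - 1)) = bvec e (2 * i))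
  (Heps : forall i, (3 <= i <= 2 * n - 2)%N -> eps i = -1 \/ eps i = 1)
  (Heg : forall x y, g x y =
     odot (bcovec e 1) (bcovec e (2 * n)) x y
     - odot (bcovec e 2) (bcovec e (2 * n - 1)) x y
     + \sum_(3 <= i < (2 * n - 2).+1)
         eps i * tens (bcovec e i) (bcovec e i) x y)
  (HV : V = bspan e 3 (2 * n - 2)) :
  pseudo_kahler br J g <->
  exists (A : 'End(subvs_of V)) (v : subvs_of V) (a c1 c2 : R),
    unitary_lie (restr_end V J) (@restr_form R L V g) A /\
    has_block_matrix (bvec e 1) (bvec e 2) (bvec e (2 * n - 1)) D
      (restr_end V J) (@restr_form R L V g) A v a c1 c2.
Proof.
have [JJ nondeg gJ] := HJg.
have n_gt0 : (0 < n)%N by case: Hh => dim_h _ _; move: dim_h; rewrite Hdim; lia.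
have n_gt1 := split_form_gt1 He n_gt0 nondeg Heg.
have := basis_witt_frame He n_gt1 HeJ Heg; rewrite -Heh -HV.
set p := bvec e 1; set q := bvec e 2; set r := bvec e (2 * n - 1).
set s := bvec e (2 * n) => frame.
have [br_alt _] := Hlie; have [_ h_ideal h_abel] := Hh.
have T_h x : x \in h -> ad br s x \in h by move=> hx; rewrite lfunE/= h_ideal.
have mem_h := frame_h frame.
have gsp : g s p = 1 by rewrite formC (frame_ps frame).
have grp : g r p = 0 by rewrite formC (frame_pr frame).
have intE := integrable_commute br_alt h_abel mem_h gsp JJ (frame_Jr frame) grp.
have clE := closed_symplectic br_alt h_abel mem_h gsp JJ gJ.
rewrite HD; split=> [[_ /intE com /clE symp] | [A [v [a [c1 [c2 [A_u blk]]]]]]].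
  exact: (block_form_exists frame JJ gJ T_h Hehperp com symp).
split=> //.
  exact/intE/(block_form_commute frame JJ gJ T_h A_u blk).
exact/clE/(block_form_symplectic frame JJ gJ T_h A_u blk).
Qed.
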